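(* Let $\mathcal{X}\subset\mathbb{R}^2$ be a $GC_4$-set (so that $\mathcal{X}$ consists of 15 nodes). Then $\mathcal{X}$ contains five collinear nodes, i.e. there is a line in the plane passing through at least five points of $\mathcal{X}$.
   Context: $\Pi_n$ denotes the space of bivariate (real) polynomials of total degree not greater than $n$; its dimension is $N=\binom{n+2}{2}$ (so $N=15$ for $n=4$). A set $\mathcal{X}=\{(x_1,y_1),\dots,(x_s,y_s)\}$ of distinct points (nodes) of the plane is called $n$-poised if for any data $\{c_1,\dots,c_s\}$ there exists a unique polynomial $p\in\Pi_n$ with $p(x_i,y_i)=c_i$ for $i=1,\dots,s$; this forces $s=N$. An $n$-fundamental polynomial of a node $A\in\mathcal{X}$ is a polynomial $p\in\Pi_n$ which equals $1$ at $A$ and vanishes at all the other nodes of $\mathcal{X}$; for an $n$-poised set it is unique and is denoted $p_A^\star$. An $n$-poised set $\mathcal{X}$ is called a $GC_n$-set if every node $A\in\mathcal{X}$ has an $n$-fundamental polynomial which is a product of $n$ linear factors (polynomials of degree one). *)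

(* Defs.v *)
From mathcomp Require Import all_boot all_order all_algebra.
From mathcomp Require Import finmap.
From mathcomp Require Import reals.
From mathcomp Require Import mpoly.

Set Implicit Arguments.
Unset Strict Implicit.
Unset Printing Implicit Defensive.

Local Open Scope fset_scope.
Local Open Scope ring_scope.

Section GCSets.
Variable R : realType.

Definition point := 'rV[R]_2.

(* The coordinates of [A] are [A 0 0] and [A 0 1]; [A 0] is the valuation
   ['I_2 -> R] expected by [meval]. *)
Definition peval (p : {mpoly R[2]}) (A : point) : R := p.@[A 0].

(* [msize p] is the total degree of [p] plus one, and [msize 0 = 0]. *)
Definition Pi (n : nat) (p : {mpoly R[2]}) : Prop := (msize p <= n.+1)%N.

Definition poised (n : nat) (X : {fset point}) : Prop :=
  forall c : point -> R,
    exists! p : {mpoly R[2]},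
      Pi n p /\ (forall A, A \in X -> peval p A = c A).

Definition fundamental (n : nat) (X : {fset point}) (A : point)
    (p : {mpoly R[2]}) : Prop :=
  [/\ Pi n p, peval p A = 1
    & forall B, B \in X -> B != A -> peval p B = 0].

Definition linear_poly (l : {mpoly R[2]}) : Prop := msize l = 2%N.

Definition GC_set (n : nat) (X : {fset point}) : Prop :=
  poised n X /\
  (forall A, A \in X ->
     exists2 p : {mpoly R[2]}, fundamental n X A p &
       exists2 l : 'I_n -> {mpoly R[2]},
         forall i, linear_poly (l i) & p = \prod_(i < n) l i).

(* For [l] of degree one, [on_line l] is the line [l = 0]; every line of the
   plane is of this form. *)
Definition on_line (l : {mpoly R[2]}) : pred point :=
  fun A => peval l A == 0.

End GCSets.

(* Main.v *)
Require Import Defs.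
From mathcomp Require Import all_boot all_order all_algebra.
From mathcomp Require Import finmap.
From mathcomp Require Import reals.
From mathcomp Require Import mpoly.
From mathcomp Require Import zify ring lra.

(** Suppose that no five nodes are collinear.  The four lines in the fundamental
    polynomial of a node [B], the lines used by [B], cover the other fourteen
    nodes and miss [B].  Comparing the lines used by two nodes shows that a line
    with two or three nodes is used by at most one node ([users_le1]) and a line
    with four nodes by at most three ([users_le3]).

    Fix a node [A].  Each of the fourteen other nodes uses a line through [A],
    while a line with [k] nodes accounts for [k - 1] of these nodes and has at
    most [k - 1] users.  Hence all these bounds are equalities: no line has
    exactly three nodes, and every node uses three lines with four nodes and one
    with two, pairwise disjoint ([card_lin24], [F_shape]).  It follows that being
    joined by a two-node line is a transitive relation ([two_closed]), so that a
    node off a four-node line is joined to at least three of its nodes by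
    four-node lines.
    (Combinatorially this is the affine plane of order four with a point
    removed.)

    Such a configuration does not exist in the real plane: take a node and a
    four-node line at the least positive distance, and argue as in Kelly's proof
    of the Sylvester-Gallai theorem ([kelly], [no_planar_configuration]).

    Poisedness enters through the number of nodes, fifteen ([poised_card]). *)

Set Implicit Arguments.
Unset Strict Implicit.
Unset Printing Implicit Defensive.
Import Order.TTheory GRing.Theory Num.Theory.

(** * Covers by sets with small intersections *)

Section Cover.
Variable T : finType.
Implicit Types (D : {set T}) (P Q : {set {set T}}).

Lemma in_cover P b x : b \in P -> x \in b -> x \in cover P.
Proof. by move=> bP xb; apply/bigcupP; exists b. Qed.

Lemma coverD P Q D :
  D \subset cover P -> D :\: cover Q \subset cover (P :\: Q).
Proof.
move=> /subsetP DP; apply/subsetP=> x /setDP[/DP/bigcupP[b bP xb] xQ].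
apply: (in_cover _ xb); rewrite inE bP andbT.
by apply: contra xQ => bQ; apply: in_cover xb.
Qed.

Lemma card_cover_bound k D P :
  D \subset cover P -> {in P, forall b, #|D :&: b| <= k} -> #|D| <= k * #|P|.
Proof.
move=> /setIidPl DP hk; rewrite -[in leqLHS]DP /cover big_distrr /=.
apply: leq_trans (_ : \sum_(b in P) #|D :&: b| <= _).
  elim/big_ind2: _ => [|m A n B hA hB|//]; first by rewrite cards0.
  exact: leq_trans (leq_card_setU _ _) (leq_add hA hB).
by rewrite mulnC -sum_nat_const; apply: leq_sum.
Qed.

Lemma card_grid_bound D P Q :
    D \subset cover P -> D \subset cover Q ->
    {in P & Q, forall b c, #|b :&: c| <= 1} ->
  #|D| <= #|Q| * #|P|.
Proof.
move=> DP DQ PQ1; apply: card_cover_bound DP _ => b bP.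
rewrite -[leqRHS]mul1n; apply: card_cover_bound => [|c cQ].
  exact: subset_trans (subsetIl _ _) DQ.
by apply: leq_trans (PQ1 b c bP cQ); rewrite subset_leq_card // setSI // subsetIr.
Qed.

End Cover.

(** * Which nodes use which lines *)

(** An abstract model of a [GC_4]-set: [lin x y] is the set of nodes on the line
    through [x] and [y], and [F B] consists of the node sets of the four lines
    used by the node [B], that is, of the factors of its fundamental
    polynomial.  The bound on [card_lin] is the assumption that no five nodes
    are collinear. *)
Section UsedLines.
Variables (T : finType) (lin : T -> T -> {set T}) (F : T -> {set {set T}}).
Hypothesis lin_l : forall x y, x \in lin x y.
Hypothesis lin_r : forall x y, y \in lin x y.
Hypothesis lin_eq : forall x y z w, x != y -> z != w ->
  z \in lin x y -> w \in lin x y -> lin z w = lin x y.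
Hypothesis card_lin : forall x y, x != y -> #|lin x y| <= 4.
Hypothesis cardF : forall B, #|F B| <= 4.
Hypothesis F_notin : forall B b, b \in F B -> B \notin b.
Hypothesis F_cover : forall A B, A != B -> exists2 b, b \in F B & A \in b.
Hypothesis F_lin : forall B b x y, b \in F B -> x != y ->
  x \in b -> y \in b -> b = lin x y.
Hypothesis card_T : #|T| = 15.

Lemma used_eq A B b c x y : b \in F A -> c \in F B -> x != y ->
  x \in b -> y \in b -> x \in c -> y \in c -> b = c.
Proof.
by move=> bA cB xy xb yb xc yc; rewrite (F_lin bA xy xb yb) (F_lin cB xy xc yc).
Qed.

Lemma used_meet A B b c : b \in F A -> c \in F B -> b != c -> #|b :&: c| <= 1.
Proof.
move=> bA cB; apply: contraNT; rewrite -ltnNge => /card_gt1P[x [y []]].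
rewrite !inE => /andP[xb xc] /andP[yb yc] xy.
by apply/eqP; apply: (used_eq bA cB xy).
Qed.

Lemma card_used A b : b \in F A -> #|b| <= 4.
Proof.
move=> bA; have [|] := leqP #|b| 1; first by lia.
by case/card_gt1P=> x [y [xb yb xy]]; rewrite (F_lin bA xy xb yb) card_lin.
Qed.

Lemma cover_F A : cover (F A) = [set~ A].
Proof.
apply/setP=> x; rewrite in_setC1; apply/bigcupP/idP => [[b bA xb]|].
  by apply: contraTN xb => /eqP->; apply: F_notin.
by move/F_cover => [b bA xb]; exists b.
Qed.

Definition common A B := F A :&: F B.

Lemma common_l A B b : b \in common A B -> b \in F A.
Proof. by case/setIP. Qed.

Lemma common_r A B b : b \in common A B -> b \in F B.
Proof. by case/setIP. Qed.

(** The nodes other than [A] and [B] that avoid the common lines lie on the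
    remaining [4 - k] lines of [A] as well as on those of [B], hence among the
    [(4 - k) ^ 2] intersection points of these two families. *)
Lemma common_count A B : A != B ->
  13 <= #|cover (common A B)| + (4 - #|common A B|) ^ 2.
Proof.
move=> AB; set K := common A B.
pose D := ~: [set A; B].
have cD : #|D| = 13 by rewrite cardsCs setCK cards2 AB card_T.
have DA : D \subset cover (F A) by rewrite cover_F setCS subsetUl.
have DB : D \subset cover (F B) by rewrite cover_F setCS subsetUr.
have cKD X : K \subset F X -> #|F X :\: K| <= 4 - #|K|.
  by move=> KX; rewrite cardsD (setIidPr KX) leq_sub2r.
have h : #|D :\: cover K| <= #|F B :\: K| * #|F A :\: K|.
  apply: card_grid_bound; try exact: coverD.
  move=> b c /setDP[bA bK] /setDP[cB _]; apply: (used_meet bA cB).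
  by apply: contraNneq bK => bc; rewrite inE bA bc.
have := leq_trans h (leq_mul (cKD _ (subsetIr _ _)) (cKD _ (subsetIl _ _))).
have := cardsID (cover K) D; rewrite cD.
have := subset_leq_card (subsetIr D (cover K)).
by rewrite expnS expn1; lia.
Qed.

(** Two nodes that share a line share exactly one or exactly three lines, all
    with four nodes.  For one common line [l], [common_count] reads
    [13 <= #|l| + 9]; for two it would read [13 <= 8 + 4]; for three it reads
    [13 <= 12 + 1], so that the lines are disjoint; four common lines would pass through [B] because those of [A]
    do. *)
Lemma common_cases A B l : A != B -> l \in common A B ->
    #|l| = 4 /\ common A B = [set l] \/
  [/\ #|common A B| = 3, #|cover (common A B)| = 12, trivIset (common A B)
    & {in common A B, forall b : {set T}, #|b| = 4}].
Proof.
move=> AB lK; have := common_count AB; set K := common A B in lK *.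
have K4 b : b \in K -> #|b| <= 4 by move/common_l/card_used.
have cK : #|K| <= 4 by apply: leq_trans (cardF A); rewrite subset_leq_card // subsetIl.
have [cov_le triv] := leq_card_cover K.
have sumK : \sum_(b in K) #|b| <= #|K| * 4 by rewrite -sum_nat_const leq_sum.
have K0 : 0 < #|K| by apply/card_gt0P; exists l.
have K_neq4 : #|K| != 4.
  apply/eqP=> K4'; have /eqP KA : K == F A by rewrite eqEcard subsetIl K4' cardF.
  have [b bA Bb] : exists2 b, b \in F A & B \in b by apply: F_cover; rewrite eq_sym.
  by move: Bb; apply/negP; apply: F_notin; apply: (@common_r A); rewrite -/K KA.
have [K1|K1] := eqVneq #|K| 1.
  move=> _; left; move/eqP/cards1P: K1 lK triv => [m Km]; rewrite Km inE => /eqP->.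
  have := common_count AB; rewrite -/K Km cards1 cover1 => h _; split=> //.
  by have := K4 m; rewrite Km inE eqxx => /(_ isT); move: h; lia.
have [K2|K2] := eqVneq #|K| 2; first by rewrite K2; move: K2 cov_le sumK; lia.
have K3 : #|K| = 3 by lia.
rewrite K3 => h; right; split=> //; first by move: cov_le sumK; rewrite K3; lia.
  by rewrite -triv; apply/eqP; move: cov_le sumK h; rewrite K3; lia.
move=> b bK; have := K4 b bK.
have : \sum_(c in K :\ b) #|c| <= #|K :\ b| * 4.
  by rewrite -sum_nat_const; apply: leq_sum => c /setD1P[_ /K4].
have KD : #|K :\ b| = 2 by move: K3; rewrite (cardsD1 b) bK; lia.
move: cov_le; rewrite KD (big_setD1 b) //=; move: h; clear; lia.
Qed.

(** Only one line of [A] is not shared, so it covers all that the others miss. *)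
Lemma fourth_line A B C a : #|common A B| = 3 -> a \in F A -> a \notin common A B ->
  C != A -> C \notin cover (common A B) -> C \in a.
Proof.
move=> K3 aA aK CA CK; have [c cA Cc] := F_cover CA.
have cK : c \notin common A B by apply: contra CK => cK; apply: in_cover Cc.
suff -> : a = c by [].
have : #|F A :\: common A B| <= 1.
  by rewrite cardsD (setIidPr (subsetIl _ _)) K3 leq_subLR; apply: cardF.
by move/card_le1_eqP; apply; rewrite inE ?aK ?cK.
Qed.

(** When [A] and [B] share three lines, a further user [C] of one of them is the
    remaining node outside these lines.  If [C] were on the common line [m],
    then the third common line [n] would have to be used by [C], since four
    nodes of [n] cannot be covered by lines meeting it at most once.  So [A] and
    [C] share three lines as well, one of which, [a], is not shared with [B].
    This [a] has four nodes, but only one can be on [m] and at most two outside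
    the lines shared by [A] and [B]. *)
Lemma other_user_notin A B C l :
    A != B -> C != A -> l \in common A B -> l \in F C -> #|common A B| = 3 ->
  C \notin cover (common A B).
Proof.
move=> AB CA lK lC K3; apply/negP=> /bigcupP[m mK Cm].
have [[_ K1]|[_ cK trivK K4]] := common_cases AB lK.
  by rewrite K1 cards1 in K3.
set K := common A B in K3 lK cK trivK K4 mK.
have disj b c : b \in K -> c \in K -> b != c -> [disjoint b & c].
  exact: (trivIsetP trivK).
have mC : m \notin F C by apply/negP=> /F_notin; rewrite Cm.
have lm : l != m by apply: contraNneq mC => <-.
have [n /and3P[nl nm nK]] : exists n, [&& n != l, n != m & n \in K].
  have : 0 < #|K :\ m :\ l|.
    by have := cardsD1 m K; have := cardsD1 l (K :\ m); rewrite in_setD1 lm lK mK K3; clear; lia.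
  by case/card_gt0P=> n; rewrite !in_setD1; exists n.
have lKC : l \in common A C by rewrite inE (common_l lK).
have AC : A != C by rewrite eq_sym.
have nC : n \in F C.
  (* otherwise the four nodes of [n] lie on the three lines of [C] other than
     [l], at most one node on each *)
  apply: contraPT (K4 n nK) => nC; suff : #|n| <= 1 * #|F C :\ l|.
    have c3 : #|F C :\ l| <= 3 by have := cardF C; rewrite (cardsD1 l) lC.
    by rewrite mul1n => /leq_trans/(_ c3) + n4; rewrite n4.
  apply: card_cover_bound => [|c /setD1P[cl cC]]; last first.
    by apply: (used_meet (common_l nK) cC); apply: contraNneq nC => ->.
  apply/subsetP=> x xn; have xC : x != C.
    by apply: contraTneq Cm => <-; rewrite (disjointFr (disj _ _ nK mK nm) xn).
  have [c cC xc] := F_cover xC; apply: (in_cover _ xc); rewrite !inE cC andbT.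
  by apply: contraTneq xc => ->; rewrite (disjointFr (disj _ _ nK lK nl) xn).
have [[_ K1]|[L3 _ trivL L4]] := common_cases AC lKC.
  have : n \in common A C by rewrite inE (common_l nK).
  by rewrite K1 inE (negPf nl).
set L := common A C in lKC L3 trivL L4.
have mL : m \notin L by apply: contra mC; apply: common_r.
have KL1 : #|K :\: L| <= 1.
  have : #|L :|: K| <= 4 by apply: leq_trans (cardF A); rewrite subset_leq_card // subUset !subsetIl.
  have := cardsUI L K; have := cardsID L K; rewrite K3 L3 setIC; clear; lia.
have [a aL aK] : exists2 a, a \in L & a \notin K.
  apply/subsetPn; apply: contra mL => LK.
  by have /eqP -> : L == K by rewrite eqEcard LK K3 L3.
have aA := common_l aL.
suff : #|a| <= 3 by rewrite L4.
have sub : a :\: m \subset ~: cover K :\ A.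
  apply/subsetP=> x /setDP[xa xm]; rewrite !inE; apply/andP; split.
    by apply: contraTneq xa => ->; apply: F_notin.
  apply/bigcupP=> -[k kK xk]; have km : k != m by apply: contraNneq xm => <-.
  have [kL|kL] := boolP (k \in L).
    have ak : a != k by apply: contraNneq aK => ->.
    by rewrite (disjointFr (trivIsetP trivL _ _ aL kL ak) xa) in xk.
  by case/eqP: km; apply: (card_le1_eqP KL1); rewrite inE ?kL ?mL.
have AK : A \in ~: cover K.
  by rewrite inE; apply/bigcupP=> -[k /common_l kA]; apply/negP/F_notin.
have := subset_leq_card sub; have := cardsD1 A (~: cover K); rewrite AK.
have := cardsC (cover K); rewrite cK card_T.
have := cardsID m a; have := used_meet aA (common_l mK) (memPnC aK _ mK); clear; lia.
Qed.

(** If [A] and [B] share only [l], the nine nodes outside [l] other than [A] and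
    [B] form a 3 x 3 grid: the three other lines of [A] are the rows and those
    of [B] the columns. *)
Lemma grid_line A B l a : A != B -> common A B = [set l] -> a \in F A -> a != l ->
  #|l| = 4 -> #|a :\: l :\ B| = 3.
Proof.
move=> AB K1 aA al l4; have lK : l \in common A B by rewrite K1 inE.
have lA := common_l lK; have lB := common_r lK.
pose D := ~: (A |: (B |: l)).
have cD : #|D| = 9.
  by rewrite cardsCs setCK !cardsU1 !inE negb_or AB !F_notin // l4 card_T.
have DX X : X \in [set A; B] -> D \subset cover (F X :\ l).
  move=> XAB; apply/subsetP=> x; rewrite !inE !negb_or => /and3P[xA xB xl].
  have [|c cX xc] := @F_cover x X; first by case/set2P: XAB => ->.
  by apply: (in_cover _ xc); rewrite !inE cX andbT; apply: contraNneq xl => <-.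
have c3 X : l \in F X -> #|F X :\ l| <= 3.
  by move=> lX; have := cardF X; rewrite (cardsD1 l) lX.
have m3 b : b \in F A :\ l -> #|D :&: b| <= 3.
  case/setD1P=> bl bA; apply: leq_trans (c3 B lB); rewrite -[leqRHS]mul1n.
  apply: card_cover_bound => [|c /setD1P[cl cB]].
    by apply: subset_trans (subsetIl _ _) (DX B _); rewrite !inE eqxx orbT.
  apply: leq_trans (_ : #|b :&: c| <= 1).
    by rewrite subset_leq_card // setSI // subsetIr.
  apply: (used_meet bA cB); apply: contraNneq bl => bc.
  by rewrite -in_set1 -K1 inE bA bc.
have aX : a \in F A :\ l by rewrite !inE al.
have -> : a :\: l :\ B = D :&: a.
  apply/setP=> x; rewrite !inE !negb_or; have [->|] /= := eqVneq x A; last first.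
    by case: (x \in a); rewrite ?andbF ?andbT.
  by rewrite (negPf (F_notin aA)) !andbF.
apply/eqP; rewrite eqn_leq m3 //=.
have : #|D :\: a| <= 3 * #|F A :\ l :\ a|.
  apply: card_cover_bound => [|b /setD1P[ba bA]].
    apply/subsetP=> x /setDP[xD xa].
    have /subsetP/(_ x xD) := DX A (set21 _ _) => /bigcupP[b bA xb].
    by apply: (in_cover _ xb); rewrite in_setD1 bA andbT; apply: contraNneq xa => <-.
  by apply: leq_trans (m3 b bA); rewrite subset_leq_card // setSI // subsetDl.
have := c3 A lA; rewrite (cardsD1 a) aX.
have := cardsID a D; rewrite cD; clear; lia.
Qed.

(** All the other users of [l] lie on one line of [A].  If [A] shares three
    lines with [B] or with [C], this is the fourth line of [A].  Otherwise each
    line of [A] has three nodes in the grid of [A] and [B] and in that of [A]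
    and [C]; these grids differ by exchanging [B] and [C], so a row contains
    both or neither. *)
Lemma users_collinear A B C l a :
    A != B -> A != C -> l \in F A -> l \in F B -> l \in F C ->
  a \in F A -> B \in a -> C \in a.
Proof.
move=> AB AC lA lB lC aA Ba.
have al : a != l by apply: contraTneq Ba => ->; apply: F_notin.
have lAB : l \in common A B by rewrite inE lA.
have lAC : l \in common A C by rewrite inE lA.
have CA : C != A by rewrite eq_sym.
have BA : B != A by rewrite eq_sym.
have [[l4 gAB]|[K3 _ _ _]] := common_cases AB lAB; last first.
  have aK : a \notin common A B by apply/negP=> /common_r/F_notin; rewrite Ba.
  exact: (fourth_line K3 aA aK CA (other_user_notin AB CA lAB lC K3)).
have [[_ gAC]|[K3 _ _ _]] := common_cases AC lAC; last first.
  have BK := other_user_notin AC BA lAC lB K3.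
  have aK : a \notin common A C by apply: contra BK => aK; apply: in_cover Ba.
  apply: (fourth_line K3 aA aK CA).
  by apply/bigcupP=> -[k /common_r/F_notin/negP].
have := grid_line AC gAC aA al l4; rewrite -(grid_line AB gAB aA al l4).
have := cardsD1 B (a :\: l); have := cardsD1 C (a :\: l).
rewrite !inE Ba !F_notin //= => -> + h; rewrite h.
by case: (C \in a) => //; clear; lia.
Qed.

Definition users (l : {set T}) := [set B | l \in F B].

(** With four users [A], [B], [C], [E], a line of [A] passes through [B], [C] and
    [E], and a line of [B] through [A], [C] and [E].  Having [C] and [E] in common
    they coincide, but no line of [A] contains [A]. *)
Lemma users_le3 (l : {set T}) : #|users l| <= 3.
Proof.
rewrite leqNgt; apply/negP=> U4.
have [A AU] : exists A, A \in users l by apply/card_gt0P; lia.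
have : 2 < #|users l :\ A| by move: U4; rewrite (cardsD1 A) AU.
case/card_gt2P=> B [C [E [[]]]]; rewrite !inE in AU * => /andP[BA lB] /andP[CA lC].
move=> /andP[EA lE] [BC CE EB].
have [a aA Ba] := F_cover BA.
have Ca : C \in a by apply: (users_collinear _ _ AU lB lC aA Ba); rewrite eq_sym.
have Ea : E \in a by apply: (users_collinear _ _ AU lB lE aA Ba); rewrite eq_sym.
have [|b bB Cb] := @F_cover C B; first by rewrite eq_sym.
have Eb : E \in b by apply: (users_collinear BC _ lB lC lE bB Cb); rewrite eq_sym.
have Ab : A \in b by apply: (users_collinear BC BA lB lC AU bB Cb).
have ab : a = b by apply: (used_eq aA bB CE).
by have := F_notin aA; rewrite ab Ab.
Qed.

Lemma users_le1 (l : {set T}) : #|l| <= 3 -> #|users l| <= 1.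
Proof.
move=> l3; apply/card_le1_eqP=> B A; rewrite !inE => lB lA.
apply/eqP; apply/negP=> /negP AB.
have lK : l \in common A B by rewrite inE lA.
by have [[l4 _]|[_ _ _ /(_ l lK) l4]] := common_cases AB lK; rewrite l4 in l3.
Qed.

Lemma card_lin_gt1 x y : x != y -> 1 < #|lin x y|.
Proof. by move=> xy; apply/card_gt1P; exists x, y. Qed.

Lemma users_bound x y : x != y -> #|users (lin x y)| <= #|lin x y|.-1.
Proof.
move=> xy; have := users_le3 (lin x y); have := @users_le1 (lin x y).
by have := card_lin_gt1 xy; have := card_lin xy; lia.
Qed.

(** The lines through [A] partition the other fourteen nodes, and each of these
    nodes uses a line through [A].  A line with [k] nodes has at most [k - 1]
    users, so summing over the lines through [A] gives
    [14 <= \sum #|users l| <= \sum (#|l| - 1) = 14], and equality holds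
    throughout. *)
Definition star A := [set lin A x | x in [set~ A]].

Lemma sum_star A : \sum_(l in star A) #|l|.-1 = 14.
Proof.
have <- : #|[set~ A]| = 14 by rewrite cardsC1 card_T.
rewrite -sum1_card (partition_big_imset (lin A)) /=; apply: eq_bigr => l lA.
rewrite sum1dep_card; case/imsetP: lA => y; rewrite in_setC1 => yA ->.
have Ay : A != y by rewrite eq_sym.
rewrite (cardsD1 A (lin A y)) lin_l /=; apply: eq_card => x; rewrite !inE.
have [//|xA /=] := eqVneq x A; apply/idP/eqP => [xl|<-]; last exact: lin_r.
by apply: lin_eq => //; rewrite eq_sym.
Qed.

Lemma star_used A B b : A != B -> b \in F B -> 1 < #|b| -> A \in b -> b \in star A.
Proof.
move=> AB bB b2 Ab; have [x] : exists x, x \in b :\ A.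
  by apply/card_gt0P; move: b2; rewrite (cardsD1 A) Ab.
rewrite !inE => /andP[xA xb]; apply/imsetP; exists x; first by rewrite !inE.
by apply: (F_lin bB) => //; rewrite eq_sym.
Qed.

(** Three lines cover at most twelve of the fourteen nodes other than [B]. *)
Lemma card_used_gt1 B b : b \in F B -> 1 < #|b|.
Proof.
move=> bB; have [+ _] := leq_card_setU b (cover (F B :\ b)).
have <- : cover (F B) = b :|: cover (F B :\ b).
  by rewrite -{1}(setD1K bB) /cover bigcup_setU big_set1.
rewrite cover_F cardsC1 card_T.
have : #|cover (F B :\ b)| <= 4 * #|F B :\ b|.
  apply: card_cover_bound => // c /setD1P[_ cB].
  by apply: leq_trans (card_used cB); rewrite subset_leq_card // subsetIr.
have := cardF B; rewrite (cardsD1 b) bB; lia.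
Qed.

Lemma sum_users_star A :
  \sum_(l in star A) #|users l| = \sum_(B | B != A) #|star A :&: F B|.
Proof.
transitivity (\sum_(l in star A) \sum_(B | l \in F B) 1).
  by apply: eq_bigr => l _; rewrite sum1dep_card.
rewrite (exchange_big_dep (fun B => B != A)) /= => [|l B lA lB].
  by apply: eq_bigr => B _; rewrite sum1dep_card; apply: eq_card => l; rewrite !inE.
apply: contraTneq lB => ->; case/imsetP: lA => x _ ->.
by apply/negP=> /F_notin; rewrite lin_l.
Qed.

Lemma star_meets A B : A != B -> 0 < #|star A :&: F B|.
Proof.
move=> AB; have [b bB Ab] := F_cover AB; apply/card_gt0P; exists b.
by rewrite inE bB (star_used AB bB) // (card_used_gt1 bB).
Qed.

Lemma sum_star_meets A : \sum_(B | B != A) #|star A :&: F B| = 14.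
Proof.
apply/eqP; rewrite eqn_leq; apply/andP; split.
  rewrite -sum_users_star -(sum_star A); apply: leq_sum => l /imsetP[x].
  by rewrite in_setC1 eq_sym => xA ->; apply: users_bound.
have <- : #|[set~ A]| = 14 by rewrite cardsC1 card_T.
rewrite -sum1_card [leqRHS](eq_bigl (mem [set~ A])) => [|B]; last by rewrite !inE.
by apply: leq_sum => B; rewrite in_setC1 eq_sym; apply: star_meets.
Qed.

Lemma card_users x y : x != y -> #|users (lin x y)| = #|lin x y|.-1.
Proof.
move=> xy; apply/eqP.
have bnd l : l \in star x -> #|users l| <= #|l|.-1 ?= iff (#|users l| == #|l|.-1).
  by case/imsetP=> z; rewrite in_setC1 eq_sym => xz ->; split=> //; apply: users_bound.
have [_] := leqif_sum bnd.
rewrite sum_users_star sum_star_meets sum_star eqxx => /esym/forall_inP; apply.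
by apply: imset_f; rewrite in_setC1 eq_sym.
Qed.

Lemma star_meets1 A B : A != B -> #|star A :&: F B| = 1.
Proof.
move=> AB; apply/esym/eqP.
have bnd C : C != A -> 1 <= #|star A :&: F C| ?= iff (1 == #|star A :&: F C|).
  by rewrite eq_sym => CA; split=> //; apply: star_meets.
have [_] := leqif_sum bnd; rewrite sum_star_meets.
rewrite sum1dep_card cardsE -[X in X == _]/(#|predC1 A|) cardC1 card_T eqxx.
by move=> /esym/forall_inP; apply; rewrite eq_sym.
Qed.

(** A line with three nodes would need two users, but has at most one. *)
Lemma card_lin24 x y : x != y -> #|lin x y| = 2 \/ #|lin x y| = 4.
Proof.
move=> xy; have := card_users xy; have := @users_le1 (lin x y).
by have := card_lin_gt1 xy; have := card_lin xy; lia.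
Qed.

Lemma card_used24 B b : b \in F B -> #|b| = 2 \/ #|b| = 4.
Proof.
move=> bB; have /card_gt1P[x [y [xb yb xy]]] := card_used_gt1 bB.
by rewrite (F_lin bB xy xb yb); apply: card_lin24.
Qed.

Lemma triv_F B : trivIset (F B).
Proof.
apply/trivIsetP=> b c bB cB; apply: contraNT => /pred0Pn[x /andP[/= xb xc]].
have xB : x != B by apply: contraTneq xb => ->; apply: F_notin.
apply/eqP; have /card_le1_eqP := eq_leq (star_meets1 xB); apply.
  by rewrite inE cB (star_used xB) // (card_used_gt1 cB).
by rewrite inE bB (star_used xB) // (card_used_gt1 bB).
Qed.

(** The lines of [B] are disjoint, have two or four nodes each, and cover
    fourteen nodes: 4 + 4 + 4 + 2 is the only possibility. *)
Lemma F_shape B : exists2 t, t \in F B & 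
  [/\ #|t| = 2, #|F B :\ t| = 3 & {in F B :\ t, forall b : {set T}, #|b| = 4}].
Proof.
have sumF : \sum_(b in F B) #|b| = 14.
  by have /eqP -> := triv_F B; rewrite cover_F cardsC1 card_T.
have [t tB t2] : exists2 t, t \in F B & #|t| == 2.
  apply/exists_inP; apply: contraT; rewrite negb_exists_in => /forall_inP h.
  move: sumF; rewrite (eq_bigr (fun=> 4)) => [|b bB].
    by rewrite sum_nat_const; lia.
  by have := h b bB; have [->|] := card_used24 bB.
exists t => //.
have FD : #|F B| = (#|F B :\ t|).+1 by rewrite (cardsD1 t) tB.
have sumD : \sum_(b in F B :\ t) #|b| = 12.
  by move: sumF; rewrite (big_setD1 t) //= (eqP t2); clear; lia.
have bnd b : b \in F B :\ t -> #|b| <= 4 ?= iff (#|b| == 4).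
  by case/setD1P=> _ bB; split=> //; apply: card_used bB.
have [le4 /esym] := leqif_sum bnd.
rewrite sumD sum_nat_const in le4 *; have := cardF B => cF.
have c3 : #|F B :\ t| = 3 by lia.
rewrite c3 eqxx => /forall_inP h4; split=> //; first exact/eqP.
by move=> b bB; apply/eqP/h4.
Qed.

Lemma F_two_unique B s t : s \in F B -> t \in F B -> #|s| = 2 -> #|t| = 2 -> s = t.
Proof.
have [u uB [u2 _ h4]] := F_shape B.
have key v : v \in F B -> #|v| = 2 -> v = u.
  by move=> vB v2; apply/eqP; apply: contra_eqT v2 => vu; rewrite h4 // !inE vu.
by move=> sB tB /(key _ sB) -> /(key _ tB) ->.
Qed.

(** Let [t] be the two-node line of [A], and [l] another line of [A].  A user [B]
    of [l] cannot share only [l] with [A], because [t] would be a row of a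
    3 x 3 grid.  So [A] and [B] share the three four-node lines of [A], which
    forces [B] to lie on [t].  As [l] has two users besides [A], both nodes of
    [t] are users of [l]. *)
Lemma triple_closed A P t :
  t \in F A -> #|t| = 2 -> P \in t -> F A :\ t \subset F P.
Proof.
move=> tA t2 Pt; have [u uA [u2 c3 h4]] := F_shape A.
have ut : u = t by apply: (F_two_unique uA).
rewrite {u uA u2}ut in c3 h4.
have shared l B : l \in F A :\ t -> l \in F B -> A != B -> F A :\ t = common A B /\ B \in t.
  move=> lAt lB AB; have /setD1P[lt lA] := lAt.
  have lK : l \in common A B by rewrite inE lA.
  have [[l4 K1]|[K3 _ _ K4]] := common_cases AB lK.
    rewrite eq_sym in lt; have := grid_line AB K1 tA lt l4.
    have := subset_leq_card (subset_trans (subD1set (t :\: l) B) (subsetDl _ _)).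
    by rewrite t2 => + t3; rewrite t3.
  have Kt : F A :\ t = common A B.
    apply/esym/eqP; rewrite eqEcard c3 K3 leqnn andbT; apply/subsetP=> k kK.
    by rewrite !inE (common_l kK) andbT; apply/eqP=> kt; have := K4 k kK; rewrite kt t2.
  split=> //; have BA : B != A by rewrite eq_sym.
  have tK : t \notin common A B by rewrite -Kt !inE eqxx.
  apply: (fourth_line K3 tA tK BA).
  by apply/bigcupP=> -[k /common_r/F_notin/negP].
have [l lAt] : exists l, l \in F A :\ t by apply/card_gt0P; rewrite c3.
have /setD1P[lt lA] := lAt.
have Ut : users l :\ A = t.
  apply/eqP; rewrite eqEcard t2; apply/andP; split.
    apply/subsetP=> B; rewrite !inE eq_sym => /andP[AB lB].
    by have [] := shared l B lAt lB AB.
  have /card_gt1P[x [y [xl yl xy]]] := card_used_gt1 lA.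
  by have := card_users xy; rewrite -(F_lin lA xy xl yl) (h4 l lAt) (cardsD1 A) inE lA /= add1n => -[->].
have : P \in users l :\ A by rewrite Ut.
rewrite !inE eq_sym => /andP[AP lP].
by have [-> _] := shared l P lAt lP AP; apply: subsetIr.
Qed.

(** If [A] is the user of the two-node line [P R], then the two-node line used by
    [P] is [A R]: by [triple_closed] the four-node lines of [P] are those of [A],
    and they miss [A], [P] and [R]. *)
Lemma two_mate P R : P != R -> #|lin P R| = 2 ->
  exists A, [/\ A != R, lin A R \in F P & #|lin A R| = 2].
Proof.
move=> PR c2; have := card_users PR; rewrite c2 => /eqP/cards1P[A UA].
have tA : lin P R \in F A by have := set11 A; rewrite -UA inE.
set t := lin P R in tA c2.
have Pt : P \in t by apply: lin_l.
have Rt : R \in t by apply: lin_r.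
have AR : A != R by apply: contraTneq Rt => <-; apply: F_notin.
have AP : A != P by apply: contraTneq Pt => <-; apply: F_notin.
have sub := triple_closed tA c2 Pt.
have [u uP [u2 c3 h4]] := F_shape P.
have [v vA [v2 d3 k4]] := F_shape A.
have vt : v = t by apply: (F_two_unique vA).
rewrite {v vA v2}vt in d3 k4.
have FPu : F P :\ u = F A :\ t.
  apply/esym/eqP; rewrite eqEcard c3 d3 leqnn andbT; apply/subsetP=> b bA.
  by rewrite !inE (subsetP sub) // andbT; apply/eqP=> bu; have := k4 b bA; rewrite bu u2.
have inu x : x != P -> (forall b, b \in F A :\ t -> x \notin b) -> x \in u.
  move=> xP h; have [b bP xb] := F_cover xP.
  suff -> : u = b by [].
  apply/esym/eqP; apply: contraTT xb => bu; apply: h; rewrite -FPu !inE bu; exact: bP.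
have Au : A \in u by apply: inu => // b /setD1P[_ bA]; apply: F_notin.
have Ru : R \in u.
  apply: inu; first by rewrite eq_sym.
  move=> b /setD1P[bt bA]; have tb : t != b by rewrite eq_sym.
  by rewrite (disjointFr (trivIsetP (triv_F A) _ _ tA bA tb) Rt).
by exists A; rewrite -(F_lin uP AR Au Ru).
Qed.

(** Both two-node lines through [P] lead, via [two_mate], to the unique two-node
    line used by [P], which therefore contains [Q] and [R]. *)
Lemma two_closed P Q R : P != Q -> P != R -> Q != R ->
  #|lin P Q| = 2 -> #|lin P R| = 2 -> #|lin Q R| = 2.
Proof.
move=> PQ PR QR /(two_mate PQ)[A [AQ sP s2]] /(two_mate PR)[B [BR tP t2]].
have st := F_two_unique sP tP s2 t2.
by rewrite (lin_eq AQ QR) // st lin_r.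
Qed.

Lemma exists_four_line A : exists2 l, l \in F A & #|l| = 4.
Proof.
have [t _ [_ c3 h4]] := F_shape A.
have [l lA] : exists l, l \in F A :\ t by apply/card_gt0P; rewrite c3.
by exists l; [case/setD1P: lA | apply: h4].
Qed.

End UsedLines.

Local Open Scope fset_scope.
Local Open Scope ring_scope.

(** * The closest point-line pair *)

Definition cross (R : realFieldType) (T : Type) (X Y : T -> R) P Q S :=
  (X Q - X P) * (Y S - Y P) - (Y Q - Y P) * (X S - X P).

Section PlanePoints.
Variables (R : realFieldType) (T : finType) (X Y : T -> R).
Local Notation cross := (cross X Y).

Definition line P Q := [set S | cross P Q S == 0].
Definition sqdist P Q := (X Q - X P) ^+ 2 + (Y Q - Y P) ^+ 2.
Definition line_sqdist P Q S := cross P Q S ^+ 2 / sqdist Q S.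
(** The scalar product of [Z - P] with the direction of the line [Q S]: up to the
    length of [S - Q], the signed distance along that line from the foot of the
    perpendicular through [P]. *)
Definition offset P Q S Z := (X Z - X P) * (X S - X Q) + (Y Z - Y P) * (Y S - Y Q).

Lemma line_l P Q : P \in line P Q.
Proof. by rewrite inE /cross !subrr !mulr0 subrr. Qed.

Lemma line_r P Q : Q \in line P Q.
Proof. by rewrite inE /cross mulrC subrr. Qed.

Hypothesis XY_inj : forall P Q, X P = X Q -> Y P = Y Q -> P = Q.

Lemma sqdist_gt0 P Q : P != Q -> 0 < sqdist P Q.
Proof.
move=> PQ; rewrite lt_def addr_ge0 ?sqr_ge0 // andbT.
apply: contra PQ; rewrite paddr_eq0 ?sqr_ge0 // !sqrf_eq0 !subr_eq0.
by case/andP=> /eqP hx /eqP hy; apply/eqP/XY_inj.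
Qed.

Lemma line_param Q S A : Q != S -> A \in line Q S ->
  exists s, X A = X Q + s * (X S - X Q) /\ Y A = Y Q + s * (Y S - Y Q).
Proof.
move=> QS; rewrite inE => /eqP hA; have N0 := lt0r_neq0 (sqdist_gt0 QS).
exists (offset Q Q S A / sqdist Q S).
split; apply/eqP; rewrite -subr_eq0 -(mulIr_eq0 _ (mulIf N0)).
  have -> : (X A - (X Q + offset Q Q S A / sqdist Q S * (X S - X Q))) * sqdist Q S
     = (X A - X Q) * sqdist Q S - offset Q Q S A * (X S - X Q) by field.
  by apply/eqP; transitivity (- (Y S - Y Q) * cross Q S A);
    [rewrite /offset /sqdist /cross; ring | rewrite hA mulr0].
have -> : (Y A - (Y Q + offset Q Q S A / sqdist Q S * (Y S - Y Q))) * sqdist Q S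
   = (Y A - Y Q) * sqdist Q S - offset Q Q S A * (Y S - Y Q) by field.
by apply/eqP; transitivity ((X S - X Q) * cross Q S A);
  [rewrite /offset /sqdist /cross; ring | rewrite hA mulr0].
Qed.

Lemma line_eq x y z w : x != y -> z != w ->
  z \in line x y -> w \in line x y -> line z w = line x y.
Proof.
move=> xy zw /(line_param xy)[s [zX zY]] /(line_param xy)[t [wX wY]].
have st : t - s != 0.
  apply: contraNneq zw => /subr0_eq ts.
  by apply/eqP/XY_inj; rewrite ?zX ?zY ?wX ?wY ts.
apply/setP=> p; rewrite !inE.
have -> : cross z w p = (t - s) * cross x y p by rewrite /cross zX zY wX wY; ring.
by rewrite mulf_eq0 (negPf st).
Qed.

(** The hypothesis on the offsets says that [A] lies between the foot of the
    perpendicular from [P] to the line [Q S] and the point [B] of that line.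
    Then [A] is closer to the line [P B] than [P] is to the line [Q S], by
    similar right triangles. *)
Lemma line_sqdist_lt P Q S A B : Q != S -> P \notin line Q S -> A != B ->
    A \in line Q S -> B \in line Q S ->
    0 <= offset P Q S A * (offset P Q S B - offset P Q S A) ->
  A \notin line P B /\ line_sqdist A P B < line_sqdist P Q S.
Proof.
move=> QS; rewrite inE => PQS AB Al Bl near.
have [s [AX AY]] := line_param QS Al; have [t [BX BY]] := line_param QS Bl.
have d0 : cross P Q S != 0.
  by apply: contra PQS => /eqP h; apply/eqP; rewrite -h /cross; ring.
have st : t - s != 0.
  apply: contraNneq AB => /subr0_eq ts.
  by apply/eqP/XY_inj; rewrite ?AX ?AY ?BX ?BY ts.
have detA : cross P B A = - ((t - s) * cross P Q S).
  by rewrite /cross AX AY BX BY; ring.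
have APB : cross P B A != 0 by rewrite detA oppr_eq0 mulf_neq0.
split; first by rewrite inE.
have PB : P != B by apply: contraNneq APB => ->; rewrite /cross !subrr !mul0r subrr.
have N0 := sqdist_gt0 QS; have M0 := sqdist_gt0 PB.
rewrite /line_sqdist ltr_pdivrMr // mulrAC ltr_pdivlMr //.
have -> : cross A P B = cross P B A by rewrite /cross; ring.
rewrite detA sqrrN exprMn mulrAC [ltRHS]mulrC ltr_pM2r ?exprn_even_gt0 //.
rewrite -(ltr_pM2r N0).
have -> : (t - s) ^+ 2 * sqdist Q S * sqdist Q S
    = (offset P Q S B - offset P Q S A) ^+ 2.
  by rewrite /offset /sqdist AX AY BX BY; ring.
have -> : sqdist P B * sqdist Q S = offset P Q S B ^+ 2 + cross P Q S ^+ 2.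
  by rewrite /offset /sqdist /cross BX BY; ring.
have : 0 < cross P Q S ^+ 2 by rewrite exprn_even_gt0.
move: near; set a := offset P Q S A; set b := offset P Q S B.
by have := sqr_ge0 a; nra.
Qed.

Lemma between_two (a b : R) : 0 <= a * b -> 0 <= a * (b - a) \/ 0 <= b * (a - b).
Proof.
have [a0|a0] := leP 0 a; have [b0|b0] := leP 0 b; have [ab|ab] := leP a b => h.
all: try (by left; nra); try (by right; nra).
Qed.

Lemma same_sign (a b c : R) : [\/ 0 <= a * b, 0 <= a * c | 0 <= b * c].
Proof.
have [a0|a0] := leP 0 a; have [b0|b0] := leP 0 b; have [c0|c0] := leP 0 c.
all: try (by apply: Or31; nra); try (by apply: Or32; nra); try (by apply: Or33; nra).
Qed.

(** Kelly's argument for the Sylvester-Gallai theorem.  Take a point [p] and a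
    rich line not through [p] at the least positive distance.  Of three points
    on this line two are on the same side of the foot of the perpendicular, and
    the line from [p] to the farther one cannot be rich, as the nearer one would
    be too close to it. *)
Lemma kelly (rich : pred {set T}) P Q S :
    Q != S -> rich (line Q S) -> P \notin line Q S ->
  exists p q s, [/\ q != s, rich (line q s), p \notin line q s &
    forall x y z, x \in line q s -> y \in line q s -> z \in line q s ->
      x != y -> x != z -> y != z ->
      ~~ [&& rich (line p x), rich (line p y) & rich (line p z)]].
Proof.
move=> QS rQS PQS.
pose ok (u : T * T * T) :=
  [&& u.1.2 != u.2, rich (line u.1.2 u.2) & u.1.1 \notin line u.1.2 u.2].
have ok0 : ok (P, Q, S) by rewrite /ok /= QS rQS.
case: (@arg_minP _ _ _ _ ok (fun u => line_sqdist u.1.1 u.1.2 u.2) ok0).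
move=> [[p q] s] /and3P[/= qs rqs pqs] min; exists p, q, s; split=> //.
move=> x y z xl yl zl xy xz yz; apply/and3P=> -[rx ry rz].
have far A B : A != B -> A \in line q s -> B \in line q s -> rich (line p B) ->
    0 <= offset p q s A * (offset p q s B - offset p q s A) -> False.
  move=> AB Al Bl rB /(line_sqdist_lt qs pqs AB Al Bl)[ApB].
  apply/negP; rewrite -leNgt; apply: (min (A, p, B)).
  by rewrite /ok /= rB ApB !andbT; apply: contraNneq pqs => ->.
have two A B : A != B -> A \in line q s -> B \in line q s ->
    rich (line p A) -> rich (line p B) -> 0 <= offset p q s A * offset p q s B -> False.
  move=> AB Al Bl rA rB /between_two[]; apply: far => //.
  by rewrite eq_sym.
have [] := same_sign (offset p q s x) (offset p q s y) (offset p q s z).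
- exact: two.
- exact: two.
- exact: two.
Qed.

End PlanePoints.

(** Call a line rich when it has four nodes.  In the pair [p], [lin q s] given by
    [kelly], at most one node of [lin q s] is joined to [p] by a two-node line,
    since by [two_closed] two such nodes would span a two-node line.  The other
    three nodes are joined to [p] by rich lines, which [kelly] forbids. *)
Lemma no_planar_configuration (R : realFieldType) (T : finType) (X Y : T -> R)
    (F : T -> {set {set T}}) :
    (forall P Q, X P = X Q -> Y P = Y Q -> P = Q) ->
    (forall P Q, P != Q -> (#|line X Y P Q| <= 4)%N) ->
    (forall B, (#|F B| <= 4)%N) ->
    (forall B b, b \in F B -> B \notin b) ->
    (forall A B, A != B -> exists2 b, b \in F B & A \in b) ->
    (forall B b x y, b \in F B -> x != y -> x \in b -> y \in b -> b = line X Y x y) ->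
  #|T| <> 15.
Proof.
move=> XY_inj line4 cF F_notin F_cover F_lin cT.
pose lin := line X Y.
have lin_l : forall x y, x \in lin x y := line_l X Y.
have lin_r : forall x y, y \in lin x y := line_r X Y.
have lin_eq := line_eq XY_inj.
have A0 : T by have /card_gt0P/sigW[A] : (0 < #|T|)%N by rewrite cT.
have [l lA l4] := exists_four_line lin_l lin_r lin_eq line4 cF F_notin F_cover F_lin cT A0.
have /card_gt1P[q0 [s0 [ql sl qs0]]] : (1 < #|l|)%N by rewrite l4.
have ll := F_lin _ _ _ _ lA qs0 ql sl.
have [||p [q [s [qs /eqP r4 pqs no3]]]] :=
  kelly XY_inj (rich := fun b : {set T} => #|b| == 4%N) (P := A0) qs0.
- by rewrite -ll l4.
- by rewrite -ll; apply: F_notin lA.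
have pz z : z \in lin q s -> p != z by apply: contraTneq => <-.
pose Two := [set z in lin q s | #|lin p z| == 2%N].
have Two1 : (#|Two| <= 1)%N.
  apply/card_le1_eqP => z y /setIdP[zl /eqP z2] /setIdP[yl /eqP y2].
  apply/eqP; apply: contraT => yz.
  have := two_closed lin_l lin_r lin_eq line4 cF F_notin F_cover F_lin cT
    (pz y yl) (pz z zl) yz y2 z2.
  by rewrite /lin (lin_eq _ _ _ _ qs yz yl zl) r4.
have := cardsID Two (lin q s).
rewrite r4 => c4; have : (2 < #|lin q s :\: Two|)%N.
  have := subset_leq_card (subsetIr (lin q s) Two); move: c4 Two1; lia.
have in4 z : z \in lin q s :\: Two -> z \in lin q s /\ #|lin p z| == 4%N.
  case/setDP=> zl; rewrite inE zl /= => z2; split=> //.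
  have [h|-> //] := card_lin24 lin_l lin_r lin_eq line4 cF F_notin F_cover F_lin cT (pz z zl).
  by rewrite h in z2.
case/card_gt2P=> x [y [z [[/in4[xl x4] /in4[yl y4] /in4[zl z4]] [xy yz zx]]]].
have := no3 x y z xl yl zl xy _ yz; rewrite eq_sym zx => /(_ isT).
by rewrite x4 y4 z4.
Qed.

(** * The number of nodes of a poised set *)

(** Passing to exponents reduces this to counting the [k]-tuples of natural
    numbers with sum at most [n]. *)
Lemma card_bmultinom k n : #|{: 'X_{1..k < n.+1}}| = 'C(k + n, k).
Proof.
rewrite -card_partial_ord_partitions.
have ltn (m : 'X_{1..k < n.+1}) i : (m i < n.+1)%N.
  by apply: leq_ltn_trans (bmdeg m); rewrite mdegE (bigD1 i) //= leq_addr.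
pose f (m : 'X_{1..k < n.+1}) : k.-tuple 'I_n.+1 := [tuple inord (m i) | i < k].
have sumf (t : k.-tuple 'I_n.+1) : (\sum_(i <- t) i = \sum_(i < k) tnth t i)%N.
  by rewrite big_tuple.
have f_inj : injective f.
  move=> m1 m2 /(congr1 (fun t => tnth t)) h; apply/val_inj/mnmP => i.
  have := congr1 (fun u => val (u i)) h.
  by rewrite /= !tnth_mktuple !inordK.
rewrite -(card_imset _ f_inj); apply: eq_card => t; rewrite inE.
apply/imsetP/idP => [[m _ ->]|ht].
  rewrite sumf (eq_bigr (fun i => m i)) => [|i _].
    by rewrite -mdegE -ltnS bmdeg.
  by rewrite tnth_mktuple inordK.
have mt : (mdeg [multinom (tnth t i : nat) | i < k] < n.+1)%N.
  rewrite mdegE ltnS; apply: leq_trans ht; rewrite sumf.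
  by apply: leq_sum => i _; rewrite mnmE.
exists (BMultinom mt) => //; apply: eq_from_tnth => i.
by apply: val_inj; rewrite tnth_mktuple /= inordK mnmE.
Qed.

Section Poised.
Variables (R : realType) (n : nat) (X : {fset point R}).
Local Notation mon := 'X_{1..2 < n.+1}.

Definition mon_comb (v : 'rV[R]_#|{: mon}|) : {mpoly R[2]} :=
  \sum_(m : mon) v 0 (enum_rank m) *: 'X_[m].

Definition eval_mx : 'M[R]_(#|{: mon}|, #|{: X}|) :=
  \matrix_(i, j) peval 'X_[(enum_val i : mon)] (fsval (enum_val j)).

Lemma mon_comb_Pi v : Pi n (mon_comb v).
Proof.
rewrite /Pi; apply: leq_trans (msize_sum _ _ _) _; apply/bigmax_leqP => m _.
by apply: leq_trans (msizeZ_le _ _) _; rewrite msizeX bmdeg.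
Qed.

Lemma mcoeff_mon_comb v (m : mon) : (mon_comb v)@_m = v 0 (enum_rank m).
Proof.
rewrite /mon_comb raddf_sum (bigD1 m) //= big1 => [|m' mm'].
  by rewrite mcoeffZ mcoeffX eqxx mulr1 addr0.
by rewrite mcoeffZ mcoeffX -bmeqP (negPf mm') mulr0.
Qed.

Lemma peval_mon_comb v A : peval (mon_comb v) (fsval A) = (v *m eval_mx) 0 (enum_rank A).
Proof.
rewrite /peval /mon_comb raddf_sum mxE /= (reindex _ (onW_bij _ (enum_val_bij _))) /=.
by apply: eq_bigr => i _; rewrite mevalZ mxE enum_valK enum_rankK.
Qed.

(** Uniqueness of interpolation says that the rows of the evaluation matrix are
    independent, existence that they span; so the matrix is square. *)
Lemma poised_card : poised n X -> #|{: X}| = 'C(n.+2, 2).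
Proof.
move=> poisedX; rewrite -[n.+2]/(2 + n)%N -card_bmultinom; apply/esym.
transitivity (\rank eval_mx).
  apply/esym/eqP/inj_row_free => v hv; have [q [_ q_uniq]] := poisedX (fun=> 0).
  have e0 : q = 0.
    by apply: q_uniq; rewrite /Pi msize0; split=> // A _; rewrite /peval meval0.
  have ev : q = mon_comb v.
    apply: q_uniq; split=> [|A AX]; first exact: mon_comb_Pi.
    by rewrite -[A]/(fsval [` AX]) peval_mon_comb hv mxE.
  apply/rowP=> i; rewrite -[i]enum_valK -mcoeff_mon_comb -ev e0 mcoeff0 mxE.
  by [].
apply/eqP/row_fullP.
have col_ex (j : 'I_#|{: X}|) : exists v : 'rV_#|{: mon}|, v *m eval_mx = delta_mx 0 j.
  have [p [[pPi pE] _]] := poisedX (fun A => (A == fsval (enum_val j))%:R).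
  exists (\row_i p@_(enum_val i : mon)); apply/rowP=> i.
  rewrite -[i]enum_valK -peval_mon_comb.
  have -> : mon_comb (\row_i0 p@_(enum_val i0 : mon)) = p.
    rewrite [RHS](mpolywE pPi); apply: eq_bigr => m _.
    by rewrite mxE enum_rankK.
  rewrite pE ?fsvalP // mxE eqxx /= enum_valK.
  by rewrite (inj_eq val_inj) (inj_eq enum_val_inj).
have [f hf] := fin_all_exists col_ex.
exists (\matrix_i f i); apply/row_matrixP => i.
by rewrite row_mul rowK hf row1.
Qed.

End Poised.

(** * Polynomials of degree one and lines *)

Section LinearPolynomials.
Variable R : realType.
Implicit Types (l : {mpoly R[2]}) (A B C : point R).

Definition affine (a b c : R) : {mpoly R[2]} := a *: 'X_0 + b *: 'X_1 + c%:MP.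

Lemma peval_affine a b c A : peval (affine a b c) A = a * A 0 0 + b * A 0 1 + c.
Proof. by rewrite /peval !mevalD !mevalZ !mevalXU mevalC. Qed.

Lemma affine0 a b c : (affine a b c)@_U_(0) = a.
Proof.
rewrite !mcoeffD !mcoeffZ !mcoeffX mcoeffC !eq_mnm1 mnm1_eq0 eqxx /=.
by rewrite mulr1 !mulr0 !addr0.
Qed.

Lemma affine1 a b c : (affine a b c)@_U_(1) = b.
Proof.
rewrite !mcoeffD !mcoeffZ !mcoeffX mcoeffC !eq_mnm1 mnm1_eq0 eqxx /=.
by rewrite mulr1 !mulr0 addr0 add0r.
Qed.

Lemma affine_const a b c : (affine a b c)@_0%MM = c.
Proof.
rewrite !mcoeffD !mcoeffZ !mcoeffX mcoeffC !mnm1_eq0 eqxx.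
by rewrite mulr1 !mulr0 !add0r.
Qed.

Lemma msize_affine a b c : (msize (affine a b c) <= 2)%N.
Proof.
have le1 (x : R) (i : 'I_2) : (msize (x *: 'X_i) <= 2)%N.
  by apply: leq_trans (msizeZ_le _ _) _; rewrite msizeX mdeg1.
apply: leq_trans (msizeD_le _ _) _; rewrite geq_max; apply/andP; split.
  by apply: leq_trans (msizeD_le _ _) _; rewrite geq_max !le1.
by rewrite msizeC; case: (c == 0).
Qed.

Lemma affineE l : (msize l <= 2)%N -> l = affine l@_U_(0) l@_U_(1) l@_0%MM.
Proof.
move=> l2; apply/mpolyP=> m; have [m1|] := ltnP 1 (mdeg m).
  have coef0 p : (msize p <= 2)%N -> p@_m = 0.
    by move=> p2; apply/memN_msupp_eq0/msize_mdeg_ge/(leq_trans p2).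
  by rewrite !coef0 ?msize_affine.
rewrite leq_eqVlt ltnS leqn0 mdeg_eq0 => /orP[/mdeg1P[i /eqP ->]|/eqP->].
  have : (i == 0) || (i == 1) by case: i => [[|[|]]].
  by case/orP=> /eqP ->; rewrite ?affine0 ?affine1.
by rewrite affine_const.
Qed.

Lemma linear_affine l : linear_poly l ->
  exists a b c, l = affine a b c /\ ((a != 0) || (b != 0)).
Proof.
move=> l2; exists l@_U_(0), l@_U_(1), l@_0%MM.
have le : l = affine l@_U_(0) l@_U_(1) l@_0%MM by apply: affineE; rewrite l2.
split=> //; apply: contraT; rewrite negb_or !negbK => /andP[/eqP a0 /eqP b0].
move: l2; rewrite /linear_poly le a0 b0 /affine !scale0r !add0r msizeC.
by case: (_ == 0).
Qed.

Lemma affine_linear a b c : (a != 0) || (b != 0) -> linear_poly (affine a b c).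
Proof.
move=> ab; apply/eqP; rewrite eqn_leq msize_affine /=.
have lt1 i : (affine a b c)@_U_(i) != 0 -> (1 < msize (affine a b c))%N.
  by rewrite -mcoeff_msupp => /msize_mdeg_lt; rewrite mdeg1.
by case/orP: ab => h; [apply: (lt1 0); rewrite affine0 | apply: (lt1 1); rewrite affine1].
Qed.

Definition xc A : R := A 0 0.
Definition yc A : R := A 0 1.

Lemma point_eq A B : xc A = xc B -> yc A = yc B -> A = B.
Proof.
move=> h0 h1; apply/rowP=> i.
have : (i == 0) || (i == 1) by case: i => [[|[|]]].
by case/orP=> /eqP ->.
Qed.

(** The normal [(a, b)] of [l] is orthogonal to [B - A], so multiplying the cross
    product by [a] or by [b] gives the value of [l] at [C] times a coordinate of
    [B - A], up to sign; neither vector is zero. *)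
Lemma on_line_cross l A B C : linear_poly l -> A != B -> on_line l A -> on_line l B ->
  on_line l C = (cross xc yc A B C == 0).
Proof.
move=> /linear_affine[a [b [c [-> ab]]]] AB; rewrite /on_line !peval_affine /cross /xc /yc.
set ux := B 0 0 - A 0 0; set uy := B 0 1 - A 0 1.
move=> /eqP lA /eqP lB.
have -> : a * C 0 0 + b * C 0 1 + c = a * (C 0 0 - A 0 0) + b * (C 0 1 - A 0 1).
  by rewrite -[LHS]subr0 -[X in _ - X]lA; ring.
set wx := C 0 0 - A 0 0; set wy := C 0 1 - A 0 1.
have u0 : a * ux + b * uy = 0.
  by transitivity ((a * B 0 0 + b * B 0 1 + c) - (a * A 0 0 + b * A 0 1 + c));
    [rewrite /ux /uy; ring | rewrite lA lB subrr].
have eqa : a * (ux * wy - uy * wx) = - uy * (a * wx + b * wy).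
  by transitivity ((a * ux + b * uy) * wy - uy * (a * wx + b * wy));
    [ring | rewrite u0 mul0r add0r mulNr].
have eqb : b * (ux * wy - uy * wx) = ux * (a * wx + b * wy).
  by transitivity (- (a * ux + b * uy) * wx + ux * (a * wx + b * wy));
    [ring | rewrite u0 oppr0 mul0r add0r].
apply/eqP/eqP => [h|d0].
  case/orP: ab => [a0|b0].
    by apply: (mulfI a0); rewrite eqa h !mulr0.
  by apply: (mulfI b0); rewrite eqb h !mulr0.
apply/eqP; apply: contraT => k0; case/negP: AB; apply/eqP.
have ux0 : ux = 0 by apply: (mulIf k0); rewrite -eqb d0 mulr0 mul0r.
have uy0 : uy = 0 by apply: oppr_inj; apply: (mulIf k0); rewrite -eqa d0 oppr0 mulr0 mul0r.
by apply/esym/point_eq; apply: subr0_eq.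
Qed.

Lemma line_through A B : A != B -> exists l, [/\ linear_poly l, on_line l A & on_line l B].
Proof.
move=> AB.
exists (affine (A 0 1 - B 0 1) (B 0 0 - A 0 0) (A 0 0 * B 0 1 - A 0 1 * B 0 0)).
split.
- apply: affine_linear; apply: contraT; rewrite negb_or !negbK !subr_eq0.
  by case/andP=> /eqP h1 /eqP h0; case/negP: AB; apply/eqP/point_eq.
- by rewrite /on_line peval_affine; apply/eqP; ring.
- by rewrite /on_line peval_affine; apply/eqP; ring.
Qed.

End LinearPolynomials.

Theorem theorem2p3 (R : realType) (X : {fset point R}) (GC4 : GC_set 4 X) :
  exists2 l : {mpoly R[2]}, linear_poly l &
    (5 <= #|` [fset A in X | on_line l A]|)%N.
Proof.
have [poisedX fundX] := GC4.
pose x (A : X) := xc (fsval A); pose y (A : X) := yc (fsval A).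
have onE l (A B C : X) : linear_poly l -> A != B ->
    on_line l (fsval A) -> on_line l (fsval B) ->
    (C \in line x y A B) = on_line l (fsval C).
  by move=> l1 AB lA lB; rewrite inE (on_line_cross _ l1 AB lA lB).
have [/existsP[[A B] /andP[/= AB AB5]]|no5] :=
    boolP [exists u : X * X, (u.1 != u.2) && (4 < #|line x y u.1 u.2|)%N].
  have [l [l1 lA lB]] := @line_through _ (fsval A) (fsval B) AB.
  exists l => //; apply: leq_trans AB5 _; rewrite cardE -(size_map (@fsval _ X)).
  apply: uniq_leq_size; first by rewrite map_inj_uniq ?enum_uniq //; apply: val_inj.
  move=> _ /mapP[C + ->]; rewrite mem_enum (onE l) // => lC.
  by rewrite !inE fsvalP.
have chosen (A : X) : exists l : 'I_4 -> {mpoly R[2]},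
    (forall i, linear_poly (l i)) /\ fundamental 4 X (fsval A) (\prod_(i < 4) l i).
  by have [p fp [l l1 pE]] := fundX _ (fsvalP A); exists l; rewrite -pE.
have [L hL] := fin_all_exists chosen.
have pevalL A B : peval (\prod_(i < 4) L A i) B = \prod_(i < 4) peval (L A i) B.
  exact: rmorph_prod.
pose block A i := [set B : X | on_line (L A i) (fsval B)].
pose F A := [set block A i | i : 'I_4].
exfalso; apply: (@no_planar_configuration _ _ x y F _ _ _ _ _ _ (poised_card poisedX)).
- by move=> P Q hx hy; apply/val_inj/point_eq.
- move=> P Q PQ; rewrite leqNgt; apply: contra no5 => h.
  by apply/existsP; exists (P, Q); rewrite /= PQ.
- by move=> B; rewrite -[leqRHS]card_ord; apply: leq_imset_card.
- move=> B _ /imsetP[i _ ->]; rewrite inE; have [_ [_ B1 _]] := hL B.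
  apply: contra_eqN B1 => /eqP Bi.
  by rewrite pevalL (bigD1 i) //= Bi mul0r eq_sym oner_eq0.
- move=> A B AB; have [_ [_ _ B0]] := hL B.
  have := B0 _ (fsvalP A) AB; rewrite pevalL => /eqP/prodf_eq0[i _ Ai].
  by exists (block B i); [apply: imset_f | rewrite inE].
- move=> B _ P Q /imsetP[i _ ->] PQ; rewrite !inE => lP lQ.
  by apply/setP=> S; rewrite (onE (L B i)) ?inE //; have [] := hL B.
Qed.
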